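(* Let $L$ be a field, $\sigma$ an automorphism of $L$ of order $n$ with fixed field $K$, and $\rho$ an automorphism of $L$ over some field $K'\leq K$ (i.e. $\rho$ fixes $K'$ elementwise). Let $R=L[x;\sigma]$, let $F$ be a monic irreducible polynomial in $K[y]$ of degree $s$ with constant coefficient $F_0$, let $E_F=K[y]/(F(y))$, and let $R_F=R/RF(x^n)\simeq M_n(E_F)$. Let $1\le k\le n$. Then the set $$S_{n,s,k}(\eta,\rho,F):=\{a+RF(x^n)\;:\;\deg(a)\le ks,\ a_{ks}=\eta a_0^{\rho}\}$$ defines a $K'$-linear MRD code in $R_F\simeq M_n(E_F)$ with minimum distance $n-k+1$ for any $\eta\in L$ such that $$N_{L:K'}(\eta)\,N_{K:K'}\big((-1)^{sk(n-1)}F_0^k\big)\neq 1.$$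
   Context: Automorphisms are written as exponents. $L[x;\sigma]$ is the skew polynomial ring: polynomials $a=\sum_i a_ix^i$ with $a_i\in L$, usual addition, and multiplication determined by $xa=a^{\sigma}x$ for $a\in L$. Its centre is $K[x^n]\simeq K[y]$, so for $F\in K[y]$ the element $F(x^n)$ is central and $RF(x^n)$ is a two-sided ideal. For every irreducible $F\in K[y]$ the quotient $R_F$ is identified with the matrix ring $M_n(E_F)$, its centre being identified with $E_F$ (the class of $y$ corresponding to that of $x^n$). $N_{L:K'}$ and $N_{K:K'}$ denote the field norms. The rank of an element of $R_F$ is the rank of the corresponding matrix in $M_n(E_F)$. A code $\mathcal{C}\subseteq M_n(E)$ has minimum distance $d$ if $d$ is the minimum of $\mathrm{rank}(A-B)$ over distinct $A,B\in\mathcal{C}$. For a subfield $K'\le E$, the code is $K'$-linear if it is closed under addition and multiplication by $K'$. A $K'$-linear code in $M_n(E)$ with minimum distance $d$ satisfies $\dim_{K'}(\mathcal{C})\le n(n-d+1)[E:K']$, and it is called MRD (maximum rank distance) if equality holds. *)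

(* Defs.v *)
From HB Require Import structures.
From mathcomp Require Import all_boot all_order all_algebra all_field.
From mathcomp Require Import boolp classical_sets.

Set Implicit Arguments.
Unset Strict Implicit.
Unset Printing Implicit Defensive.

Import GRing.Theory.
Local Open Scope ring_scope.
Local Open Scope quotient_scope.

Definition is_order (T : Type) (f : T -> T) (n : nat) : Prop :=
  [/\ (0 < n)%N, iter n f =1 id &
      forall m, (0 < m < n)%N -> ~ (iter m f =1 id)].

(* The field norm N_{E:F}(a): determinant of multiplication by a on E. *)
Definition field_norm (F : fieldType) (E : fieldExtType F) (a : E) : F :=
  \det (\matrix_(i, j) coord (vbasis {:E}) j (a * (vbasis {:E})`_i)).

(* The skew polynomial ring R[x; s]. The carrier is {poly R}, whose monomials  *)
(* c *: 'X^i are read as c x^i (coefficients on the left); only the product    *)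
(* differs from that of {poly R}: (c x^i) * b = sum_j c s^i(b_j) x^(i+j).      *)
Definition skew_poly (R : nzRingType) (s : {rmorphism R -> R}) : Type :=
  {poly R}.

Section SkewPoly.
Variables (R : nzRingType) (s : {rmorphism R -> R}).
Implicit Types (p q r : {poly R}) (c : R) (i j : nat).

Definition skew_shift i q : {poly R} := map_poly (iter i s) q * 'X^i.

Definition skew_mul p q : {poly R} :=
  \sum_(i < size p) p`_i *: skew_shift i q.

Lemma iter_rmorph0 i : iter i s 0 = 0.
Proof. by elim: i => //= i ->; rewrite rmorph0. Qed.

Lemma iter_rmorph1 i : iter i s 1 = 1.
Proof. by elim: i => //= i ->; rewrite rmorph1. Qed.

Lemma iter_rmorphD i : {morph iter i s : x y / x + y}.
Proof. by elim: i => // i IH x y; rewrite !iterS IH rmorphD. Qed.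

Lemma iter_rmorphM i : {morph iter i s : x y / x * y}.
Proof. by elim: i => // i IH x y; rewrite !iterS IH rmorphM. Qed.

Lemma coef_skew_shift i q k :
  (skew_shift i q)`_k = if (k < i)%N then 0 else iter i s q`_(k - i).
Proof.
rewrite /skew_shift coefMXn; case: ifP => // _.
by rewrite coef_map_id0 // iter_rmorph0.
Qed.

Lemma skew_shiftD i : {morph skew_shift i : p q / p + q}.
Proof.
move=> p q; apply/polyP => k; rewrite coefD !coef_skew_shift coefD.
by case: ifP => _; rewrite ?addr0 ?iter_rmorphD.
Qed.

Lemma skew_shift0 i : skew_shift i 0 = 0.
Proof.
by apply/polyP => k; rewrite coef_skew_shift !coef0 iter_rmorph0 if_same.
Qed.

Lemma skew_shiftZ i c q : skew_shift i (c *: q) = iter i s c *: skew_shift i q.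
Proof.
apply/polyP => k; rewrite coefZ !coef_skew_shift coefZ.
by case: ifP => _; rewrite ?mulr0 ?iter_rmorphM.
Qed.

Lemma skew_shift_shift i j q :
  skew_shift i (skew_shift j q) = skew_shift (i + j) q.
Proof.
apply/polyP => k; rewrite !coef_skew_shift iterD.
have [lt_ki | le_ik] := ltnP k i; first by rewrite (ltn_addr j lt_ki).
rewrite ltn_subLR // subnDA; case: ifP => // _; exact: iter_rmorph0.
Qed.

Lemma skew_shift0n q : skew_shift 0 q = q.
Proof. by apply/polyP => k; rewrite coef_skew_shift subn0. Qed.

Lemma skew_shift_sum i (I : Type) (t : seq I) (f : I -> {poly R}) :
  skew_shift i (\sum_(j <- t) f j) = \sum_(j <- t) skew_shift i (f j).
Proof. exact: (big_morph _ (skew_shiftD i) (skew_shift0 i)). Qed.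

Lemma skew_mulE N p q : (size p <= N)%N ->
  skew_mul p q = \sum_(i < N) p`_i *: skew_shift i q.
Proof.
move=> le_pN; rewrite /skew_mul (big_ord_widen _ (fun i => p`_i *: skew_shift i q) le_pN).
rewrite [RHS](bigID (fun i : 'I_N => (i < size p)%N)) /= [X in _ = _ + X]big1 ?addr0 //.
by move=> i; rewrite -leqNgt => le_pi; rewrite nth_default ?scale0r.
Qed.

Lemma skew_mulDl : left_distributive skew_mul +%R.
Proof.
move=> p q r; pose N := maxn (size p) (size q).
rewrite !(@skew_mulE N) ?leq_maxl ?leq_maxr ?size_polyD // -big_split /=.
by apply: eq_bigr => i _; rewrite coefD scalerDl.
Qed.

Lemma skew_mul0p q : skew_mul 0 q = 0.
Proof. by rewrite /skew_mul size_poly0 big_ord0. Qed.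

Lemma skew_mulDr : right_distributive skew_mul +%R.
Proof.
move=> p q r; rewrite /skew_mul -big_split /=.
by apply: eq_bigr => i _; rewrite skew_shiftD scalerDr.
Qed.

Lemma skew_mulZl c p q : skew_mul (c *: p) q = c *: skew_mul p q.
Proof.
rewrite (@skew_mulE (size p)) ?size_scale_leq // /skew_mul scaler_sumr.
by apply: eq_bigr => i _; rewrite coefZ scalerA.
Qed.

Lemma skew_mul_shift i q r :
  skew_mul (skew_shift i q) r = skew_shift i (skew_mul q r).
Proof.
have le_iq : (size (skew_shift i q) <= i + size q)%N.
  apply/leq_sizeP => j le_j; rewrite coef_skew_shift.
  rewrite ltnNge (leq_trans (leq_addr _ _) le_j) /= nth_default ?iter_rmorph0 //.
  by rewrite leq_subRL // (leq_trans (leq_addr _ _) le_j).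
rewrite (skew_mulE _ le_iq) big_split_ord /= big1 => [|j _]; last first.
  by rewrite coef_skew_shift ltn_ord scale0r.
rewrite add0r /skew_mul skew_shift_sum; apply: eq_bigr => j _.
by rewrite coef_skew_shift ltnNge leq_addr /= addKn skew_shiftZ skew_shift_shift.
Qed.

Lemma skew_mulA : associative skew_mul.
Proof.
move=> p q r; rewrite {2}/skew_mul.
rewrite (big_morph (skew_mul^~ r) (fun x y => skew_mulDl x y r) (skew_mul0p r)).
by apply: eq_bigr => i _; rewrite skew_mulZl skew_mul_shift.
Qed.

Lemma skew_mul1p : left_id 1 skew_mul.
Proof.
by move=> p; rewrite /skew_mul size_poly1 big_ord1 coef1 scale1r skew_shift0n.
Qed.

Lemma skew_mulp1 : right_id 1 skew_mul.
Proof.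
move=> p; rewrite -[RHS]coefK poly_def; apply: eq_bigr => i _.
congr (_ *: _); apply/polyP => k; rewrite coef_skew_shift coefXn coef1.
case: ltngtP => [// | lt_ik | ->]; last by rewrite subnn iter_rmorph1.
by rewrite subn_eq0 leqNgt lt_ik iter_rmorph0.
Qed.

HB.instance Definition _ := GRing.Zmodule.on (skew_poly s).
HB.instance Definition _ := GRing.Zmodule_isNzRing.Build (skew_poly s)
  skew_mulA skew_mul1p skew_mulp1 skew_mulDl skew_mulDr (oner_neq0 {poly R}).

Lemma skewX_C c : ('X : skew_poly s) * c%:P = ((s c)%:P : skew_poly s) * 'X.
Proof.
transitivity (s c *: 'X : {poly R}); apply/polyP => k.
  rewrite [LHS](congr1 (fun p : {poly R} => p`_k) (skew_mulE _ (leqnn _))).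
  rewrite size_polyX big_ord_recl big_ord1 !coefX /= scale0r add0r scale1r.
  rewrite coef_skew_shift coefZ coefX coefC /=; case: k => [|[|k]] //=;
  by rewrite ?mulr0 ?mulr1 ?rmorph0.
rewrite [RHS](congr1 (fun p : {poly R} => p`_k) (skew_mulE _ (size_polyC_leq1 _))).
by rewrite big_ord1 coefC /= skew_shift0n.
Qed.

End SkewPoly.

(* The quotient of a ring A by the two-sided ideal A c, for a central c.      *)
Section CentralQuotient.
Variables (A : nzRingType) (c : A) (cC : forall a, a * c = c * a).

Definition central_ideal (cC : forall a, a * c = c * a) : {pred A} :=
  fun a => `[< exists b, a = b * c >].

Lemma central_ideal_zmod_closed : zmod_closed (central_ideal cC).
Proof.
split=> [|_ _ /asboolP[a ->] /asboolP[b ->]]; apply/asboolP.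
  by exists 0; rewrite mul0r.
by exists (a - b); rewrite mulrBl.
Qed.

HB.instance Definition _ :=
  GRing.isZmodClosed.Build A (central_ideal cC) central_ideal_zmod_closed.

Lemma central_idealMl a b : b \in central_ideal cC -> a * b \in central_ideal cC.
Proof. by case/asboolP=> d ->; apply/asboolP; exists (a * d); rewrite mulrA. Qed.

Lemma central_idealMr a b : b \in central_ideal cC -> b * a \in central_ideal cC.
Proof.
by case/asboolP=> d ->; apply/asboolP; exists (d * a); rewrite -!mulrA cC.
Qed.

Definition central_quot : Type := {ideal_quot (central_ideal cC)}.

HB.instance Definition _ := GRing.Zmodule.on central_quot.

Definition central_pi (a : A) : central_quot := \pi_({ideal_quot (central_ideal cC)}) a.

Lemma central_piP a b :
  reflect (exists d, a - b = d * c) (central_pi a == central_pi b).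
Proof.
rewrite /central_pi -Quotient.idealrBE; exact: asboolP.
Qed.

Lemma central_pi_surj u : exists a, u = central_pi a.
Proof. by exists (repr (u : {ideal_quot (central_ideal cC)})); rewrite /central_pi reprK. Qed.

Lemma central_pi_zmod : zmod_morphism central_pi.
Proof. by move=> a b; rewrite /central_pi; exact: (@pi_is_zmod_morphism _ _ _ {ideal_quot (central_ideal cC)}). Qed.

HB.instance Definition _ :=
  GRing.isZmodMorphism.Build A central_quot central_pi central_pi_zmod.

Definition central_mul (u v : central_quot) : central_quot :=
  central_pi (repr (u : {ideal_quot (central_ideal cC)}) *
              repr (v : {ideal_quot (central_ideal cC)})).

Lemma central_piM a b :
  central_mul (central_pi a) (central_pi b) = central_pi (a * b).
Proof.
apply/eqP; rewrite /central_mul /central_pi -Quotient.idealrBE.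
set a' := repr _; set b' := repr _.
have Ia : a' - a \in central_ideal cC by rewrite Quotient.idealrBE reprK.
have Ib : b' - b \in central_ideal cC by rewrite Quotient.idealrBE reprK.
have -> : a' * b' - a * b = a' * (b' - b) + (a' - a) * b.
  by rewrite mulrBr mulrBl addrA subrK.
by rewrite rpredD; [ | exact: central_idealMl | exact: central_idealMr].
Qed.

Lemma central_mulA : associative central_mul.
Proof.
move=> u v w; have [a ->] := central_pi_surj u.
have [b ->] := central_pi_surj v; have [d ->] := central_pi_surj w.
by rewrite !central_piM mulrA.
Qed.

Lemma central_mul1q : left_id (central_pi 1) central_mul.
Proof.
by move=> u; have [a ->] := central_pi_surj u; rewrite central_piM mul1r.
Qed.

Lemma central_mulq1 : right_id (central_pi 1) central_mul.
Proof.
by move=> u; have [a ->] := central_pi_surj u; rewrite central_piM mulr1.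
Qed.

Lemma central_mulDl : left_distributive central_mul +%R.
Proof.
move=> u v w; have [a ->] := central_pi_surj u.
have [b ->] := central_pi_surj v; have [d ->] := central_pi_surj w.
by rewrite !central_piM -!raddfD central_piM mulrDl.
Qed.

Lemma central_mulDr : right_distributive central_mul +%R.
Proof.
move=> u v w; have [a ->] := central_pi_surj u.
have [b ->] := central_pi_surj v; have [d ->] := central_pi_surj w.
by rewrite !central_piM -!raddfD central_piM mulrDr.
Qed.

HB.instance Definition _ := GRing.Zmodule_isPzRing.Build central_quot
  central_mulA central_mul1q central_mulq1 central_mulDl central_mulDr.

Lemma central_pi_monoid : monoid_morphism central_pi.
Proof. by split=> // a b; rewrite -[LHS]central_piM. Qed.

HB.instance Definition _ :=
  GRing.isMonoidMorphism.Build A central_quot central_pi central_pi_monoid.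

End CentralQuotient.

(* [L : K'] is finite, so every element of 'AEnd(L) is an automorphism of L    *)
(* over K', and K' is contained in the fixed field of each of them.            *)
Section Setting.
Variables (K' : fieldType) (L : fieldExtType K') (sigma : 'AEnd(L)) (n : nat).

Definition fixed_field : fieldExtType K' := subvs_of (fixedSpace sigma).

Definition skew_ring : nzRingType := skew_poly (sigma : {rmorphism L -> L}).

(* F(x^n), for F with coefficients in the fixed field of sigma. *)
Definition at_xn (F : {poly fixed_field}) : skew_ring :=
  map_poly (vsval : fixed_field -> L) F \Po 'X^n.

Section Central.
Hypothesis on : is_order sigma n.

Lemma at_xn_fixed F i j : iter i sigma (at_xn F : {poly L})`_j = (at_xn F : {poly L})`_j.
Proof.
have [n_gt0 _ _] := on; rewrite /at_xn coef_comp_poly_Xn //.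
elim: i => //= i ->; case: ifP => _; last by rewrite rmorph0.
rewrite coef_map_id0 ?linear0 //; apply/fixedSpaceP; exact: subvsP.
Qed.

Lemma iter_sigma_dvd i : (n %| i)%N -> iter i sigma =1 id.
Proof.
have [_ sn _] := on; case/dvdnP=> q -> x; rewrite mulnC.
elim: q => [|q IH]; first by rewrite muln0.
by rewrite mulnS iterD IH sn.
Qed.

Lemma at_xn_central (F : {poly fixed_field}) (a : skew_ring) :
  a * at_xn F = at_xn F * a.
Proof.
have [n_gt0 _ _] := on.
set f := at_xn F; pose f' : {poly L} := f; pose a' : {poly L} := a.
transitivity (a' * f' : {poly L}).
  rewrite -[a' in RHS]coefK poly_def mulr_suml; apply: eq_bigr => i _.
  rewrite -scalerAl mulrC; congr (_ *: (_ * _)); apply/polyP => j.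
  by rewrite coef_map_id0 ?iter_rmorph0 // at_xn_fixed.
rewrite mulrC -[f' in LHS]coefK poly_def mulr_suml; apply: eq_bigr => i _.
rewrite -scalerAl; have [ni | nNi] := boolP (n %| i)%N; last first.
  by rewrite /f' /f /at_xn coef_comp_poly_Xn // (negPf nNi) !scale0r.
rewrite mulrC; congr (_ *: (_ * _)); apply/polyP => j.
by rewrite coef_map_id0 ?iter_rmorph0 // (iter_sigma_dvd ni).
Qed.

(* R_F = R / R F(x^n). *)
Definition skew_quotient (F : {poly fixed_field}) : pzRingType :=
  central_quot (at_xn_central F).

Definition to_skew_quotient (F : {poly fixed_field}) :
    {rmorphism skew_ring -> skew_quotient F} :=
  @central_pi skew_ring (at_xn F) (at_xn_central F).

End Central.

(* E_F = K[y] / (F), as an extension of K'. *)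
Definition residue_field (F : {poly fixed_field})
    (F_mi : monic_irreducible_poly F) : fieldExtType K' :=
  baseFieldType {poly %/ F with F_mi}.

Definition residue_class (F : {poly fixed_field})
    (F_mi : monic_irreducible_poly F) (z : {poly fixed_field}) :
    residue_field F_mi :=
  in_qpoly F z.

Section Twisted.
Variables (on : is_order sigma n) (rho : 'AEnd(L)).

(* S_{n,s,k}(eta, rho, F), as a subset of R_F. *)
Definition twisted_code (s k : nat) (eta : L) (F : {poly fixed_field}) :
    set (skew_quotient on F) :=
  fun u => exists a : {poly L},
     [/\ (size a <= (k * s).+1)%N, a`_(k * s) = eta * rho a`_0 &
         u = to_skew_quotient on F a].

End Twisted.
End Setting.

Arguments twisted_code {K' L sigma n} on rho s k eta F _.

Section RankMetric.
Variables (K' : fieldType) (E : fieldExtType K') (n : nat).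
Implicit Types (C : set 'M[E]_n) (d m : nat).

(* K' acts on 'M[E]_n through its image c%:A in E. *)
Definition K'_linear C : Prop :=
  [/\ C 0, forall A B, C A -> C B -> C (A + B) &
      forall (c : K') A, C A -> C (c%:A *: A)].

Definition min_distance C d : Prop :=
  (exists A B, [/\ C A, C B, A <> B & \rank (A - B)%R = d]) /\
  (forall A B, C A -> C B -> A <> B -> (d <= \rank (A - B)%R)%N).

(* C is the K'-span of m matrices linearly independent over K'. *)
Definition K'_dim C m : Prop :=
  exists b : 'I_m -> 'M[E]_n,
    (forall A, C A <-> exists c : 'I_m -> K', A = \sum_i (c i)%:A *: b i) /\
    (forall c : 'I_m -> K', \sum_i (c i)%:A *: b i = 0 -> forall i, c i = 0).

Definition MRD_code C d : Prop :=
  [/\ K'_linear C, min_distance C d &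
      K'_dim C (n * (n - d + 1) * \dim {:E})].

End RankMetric.

(* Main.v *)
From HB Require Import structures.
Require Import Defs.
From mathcomp Require Import all_boot all_order all_algebra all_field.
From mathcomp Require Import boolp classical_sets.

Set Implicit Arguments.
Unset Strict Implicit.
Unset Printing Implicit Defensive.

Import GRing.Theory.
Local Open Scope ring_scope.
Local Open Scope classical_set_scope.

(** Write R for the skew polynomial ring and f : R -> M_n(E) for the reduction
modulo F(x^n) followed by the given isomorphism.  It is K'-linear, since a
constant of K' is the value at x^n of a constant polynomial.

Rank and degree.  Let a <> 0 in R and let the columns of v be a basis of the
column kernel of f(a), of dimension j = n - rank f(a).  The map b |-> f(b) v is
onto the n x j matrices because v has a left inverse, and it kills the left
ideal R a; dividing by a on the right, it is already onto when restricted to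
the b of degree less than deg a.  Comparing dimensions over K' gives
n j [E:K'] <= deg(a) [L:K'], and in case of equality the restriction is
injective, so that every b with f(b) = 0, in particular F(x^n), lies in R a
(corank_bound).  The same comparison applied to R_F itself gives
n [E:K'] = s [L:K'] (dim_residue), so j s <= deg a; together with
[E:K'] = s [K:K'] it also gives [L:K] = n.

Hence a codeword a <> 0, of degree at most ks, has rank at least n - k, and if
the rank is n - k then deg a = ks and a = l g with g a monic right divisor of
F(x^n).  For such a g, the product of the n conjugates of g_0 equals
(-1)^(sk(n-1)) F_0^k (right_divisor_coef0): x acts on R/Rg, a row space over L,
by the companion matrix of g composed with sigma, so x^n acts by an L-linear
map A with F(A) = 0; the characteristic polynomial of A has coefficients in K
because sigma(A) is similar to A, it divides a power of the irreducible F, and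
so by degree it is F^k.  Its constant coefficient is det A up to sign, which is
the product of the conjugates of det C = (-1)^(ks) g_0.  The similarity needs
C to be invertible; if g_0 = 0 then F_0 = 0 and the equality is trivial.

On the other hand the defining relation l = eta rho(l g_0) of the code gives
N_{L:K'}(eta) N_{L:K'}(g_0) = 1 on taking norms, since N_{L:K'} is invariant
under rho.  The transitivity N_{L:K'}(g_0) = N_{K:K'}(prod_i sigma^i(g_0))
(field_norm_cyclic) then contradicts the hypothesis on eta, so nonzero
codewords have rank at least n - k + 1 (rank_twisted).

For the transitivity, norms of polynomials are used: N extends to a map
L[t] -> K'[t].  Taking norms of r = prod_i sigma^i(p) in two ways gives
N_{L:K'}(p)^n = N_{K:K'}(r)^n; for constants this leaves an n-th root of unity
undetermined, but for p = x + (1 - x) t both norms are polynomials with value 1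
at t = 1, so they are equal, and t = 0 gives the claim.

Finally the code is the injective linear image of L^(ks), hence has dimension
ks [L:K'] = nk [E:K'], and the value n - k + 1 is attained: some nonzero codeword
has its first k - 1 rows equal to zero (MRD_of_rank_bound). *)

(** * Norms of polynomials over a finite extension *)

Section PolyNorm.
Variables (k : fieldType) (E : fieldExtType k).

Definition mulmat N (b : N.-tuple E) (x : E) : 'M[k]_N :=
  \matrix_(i, j) coord b j (x * b`_i).

(** The matrix of multiplication by [p] on [E[t]], a free [k[t]]-module with
basis [b]; its entries are obtained coefficient by coefficient. *)
Definition polymat N (b : N.-tuple E) (p : {poly E}) : 'M[{poly k}]_N :=
  \matrix_(i, j) map_poly (fun c => coord b j (c * b`_i)) p.

Definition poly_norm (p : {poly E}) : {poly k} := \det (polymat (vbasis {:E}) p).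

Lemma coef_polymat N (b : N.-tuple E) p i j l :
  (polymat b p i j)`_l = mulmat b p`_l i j.
Proof. by rewrite mxE coef_map_id0 ?mxE // mul0r linear0. Qed.

Lemma mulmatE N (b : N.-tuple E) (x : E) (i : 'I_N) :
  basis_of fullv b -> x * b`_i = \sum_j mulmat b x i j *: b`_j.
Proof.
move=> bb; rewrite {1}(coord_basis bb (memvf (x * b`_i))).
by apply: eq_bigr => j _; rewrite mxE.
Qed.

Lemma mulmat_uniq N (b : N.-tuple E) (x : E) (Q : 'M[k]_N) :
  basis_of fullv b -> (forall i : 'I_N, x * b`_i = \sum_j Q i j *: b`_j) ->
  mulmat b x = Q.
Proof.
move=> bb xQ; apply/matrixP => i j.
by rewrite mxE xQ coord_sum_free // (basis_free bb).
Qed.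

Lemma mulmat1 N (b : N.-tuple E) : basis_of fullv b -> mulmat b 1 = 1%:M.
Proof.
move=> bb; apply: mulmat_uniq => // i; rewrite mul1r (bigD1 i) //= mxE eqxx.
rewrite scale1r big1 ?addr0 // => j ne_ji.
by rewrite mxE eq_sym (negPf ne_ji) scale0r.
Qed.

Lemma polymatM N (b : N.-tuple E) p q : basis_of fullv b ->
  polymat b (p * q) = polymat b p *m polymat b q.
Proof.
move=> bb; apply/matrixP => i j; apply/polyP => l.
rewrite coef_polymat !mxE coef_sum coefM mulr_suml linear_sum /=.
under [RHS]eq_bigr => u _ do rewrite coefM.
rewrite exchange_big; apply: eq_bigr => h _ /=.
rewrite -mulrA mulrCA (mulmatE p`_h i bb) mulr_sumr linear_sum /=.
by apply: eq_bigr => u _; rewrite -scalerAr linearZ /= !coef_polymat !mxE.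
Qed.

Lemma horner_polymat N (b : N.-tuple E) p (a : k) i j :
  (polymat b p i j).[a] = mulmat b p.[a%:A] i j.
Proof.
rewrite !mxE (@horner_coef_wide _ (size p)) ?size_poly // horner_coef.
rewrite mulr_suml linear_sum; apply: eq_bigr => l _ /=.
rewrite coef_map_id0 ?mul0r ?linear0 //.
by rewrite -in_algE -rmorphXn /= mulr_algr -scalerAl linearZ mulrC.
Qed.

(** Changing the basis conjugates the matrix by an invertible constant matrix.
Both lengths are kept free because the bases used below are not indexed by the
dimension syntactically. *)
Lemma det_polymat N N' (b : N.-tuple E) (b' : N'.-tuple E) p :
  basis_of fullv b -> basis_of fullv b' ->
  \det (polymat b p) = \det (polymat b' p).
Proof.
move=> bb bb'; have eqN : N' = N.
  by rewrite -(size_basis bb); symmetry; exact: size_basis bb'.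
subst N'; pose chg (c c' : N.-tuple E) := \matrix_(i, j) coord c j c'`_i : 'M[k]_N.
have chgE (c c' : N.-tuple E) (i : 'I_N) : basis_of fullv c -> c'`_i = \sum_j chg c c' i j *: c`_j.
  move=> cb; rewrite {1}(coord_basis cb (memvf c'`_i)).
  by apply: eq_bigr => j _; rewrite mxE.
have chg1 (c c' : N.-tuple E) : basis_of fullv c -> basis_of fullv c' ->
    chg c c' *m chg c' c = 1%:M.
  move=> cb cb'; apply/matrixP=> i j; rewrite [LHS]mxE.
  have fr := basis_free cb'; have := coord_free i j fr.
  rewrite {1}(chgE c c' i cb) linear_sum mxE => <-.
  by apply: eq_bigr => u _; rewrite linearZ /= [chg c' c u j]mxE.
have detS : \det (chg b b') != 0.
  have := congr1 determinant (chg1 b b' bb bb'); rewrite det_mulmx det1.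
  by case: eqP => // ->; rewrite mul0r => /eqP; rewrite eq_sym oner_eq0.
have comm x : mulmat b' x *m chg b b' = chg b b' *m mulmat b x.
  apply/matrixP => i j; have fr := basis_free bb.
  have := congr1 (coord b j) (mulmatE x i bb').
  rewrite linear_sum /= mxE => h.
  transitivity (coord b j (x * b'`_i)).
    by rewrite h; apply: eq_bigr => u _; rewrite linearZ /= !mxE.
  rewrite (chgE b b' i bb) mulr_sumr linear_sum /= mxE; apply: eq_bigr => u _.
  by rewrite -scalerAr linearZ /= [mulmat _ _ _ _]mxE.
have : polymat b' p *m map_mx polyC (chg b b') =
       map_mx polyC (chg b b') *m polymat b p.
  apply/matrixP => i j; apply/polyP => l; rewrite !mxE !coef_sum.
  have := congr1 (fun M : 'M_N => M i j) (comm p`_l); rewrite /= !mxE => h.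
  under eq_bigr => u _ do rewrite [map_mx _ _ _ _]mxE coefMC coef_polymat.
  by rewrite h; apply: eq_bigr => u _; rewrite [map_mx _ _ _ _]mxE coefCM coef_polymat.
move/(congr1 determinant); rewrite !det_mulmx det_map_mx mulrC.
by move/mulfI => -> //; rewrite polyC_eq0.
Qed.

Lemma poly_normM p q : poly_norm (p * q) = poly_norm p * poly_norm q.
Proof. by rewrite /poly_norm polymatM ?vbasisP // det_mulmx. Qed.

Lemma horner_poly_norm p (a : k) : (poly_norm p).[a] = field_norm p.[a%:A].
Proof.
rewrite /poly_norm -[LHS]/(horner_eval a _) -det_map_mx /field_norm.
by congr (\det _); apply/matrixP => i j; rewrite mxE [LHS]horner_polymat mxE.
Qed.

Lemma field_norm_mulmat x : field_norm x = \det (mulmat (vbasis {:E}) x).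
Proof. by []. Qed.

Lemma field_norm1 : field_norm (1 : E) = 1.
Proof. by rewrite field_norm_mulmat mulmat1 ?vbasisP ?det1. Qed.

Lemma poly_norm1 : poly_norm 1 = 1.
Proof.
rewrite /poly_norm -[RHS](det1 _ (\dim {:E})); congr (\det _).
apply/matrixP => i j; apply/polyP => l; rewrite coef_polymat coef1.
case: l => [|l] /=; first by rewrite mulmat1 ?vbasisP // !mxE coefMn coef1.
by rewrite !mxE mul0r linear0 coefMn coef1 mul0rn.
Qed.

(** The matrix of [f p] in the basis [f b] is the matrix of [p] in the basis
[b]. *)
Lemma poly_norm_aut (f : 'AEnd(E)) p : poly_norm (map_poly f p) = poly_norm p.
Proof.
pose b := vbasis {:E}.
have kf : (fullv :&: lker (f : 'Hom(E, E)) = 0)%VS.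
  by rewrite (eqP (AEnd_lker0 f)) capv0.
have bb' : basis_of fullv [tuple of map f b].
  have := limg_basis_of kf (vbasisP {:E}).
  suff -> : ((f : 'Hom(E, E)) @: fullv)%VS = fullv by [].
  by apply/eqP; rewrite eqEdim subvf limg_dim_eq /=.
rewrite {1}/poly_norm (det_polymat _ (vbasisP _) bb'); congr (\det _).
apply/matrixP => i j; apply/polyP => l; rewrite !coef_polymat coef_map /=.
congr (fun_of_matrix _ i j); apply: mulmat_uniq => // u.
rewrite (nth_map 0) ?size_tuple // -rmorphM (mulmatE _ _ (vbasisP _)) rmorph_sum.
apply: eq_bigr => v _; rewrite (nth_map 0) ?size_tuple //.
rewrite /= -[in LHS]mulr_algl rmorphM /= (rmorph_alg f).
by rewrite mulr_algl.
Qed.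

End PolyNorm.

Section FieldNorm.
Variables (k : fieldType) (E : fieldExtType k).

Lemma field_norm_polyC (x : E) : field_norm x = (poly_norm x%:P).[0].
Proof. by rewrite horner_poly_norm hornerC. Qed.

Lemma field_normM (x y : E) : field_norm (x * y) = field_norm x * field_norm y.
Proof. by rewrite !field_norm_polyC rmorphM poly_normM hornerM. Qed.

Lemma field_norm_aut (f : 'AEnd(E)) x : field_norm (f x) = field_norm x.
Proof. by rewrite !field_norm_polyC -[in RHS](poly_norm_aut f) map_polyC. Qed.

Lemma field_norm_neq0 (x : E) : x != 0 -> field_norm x != 0.
Proof.
move=> x0; have := field_normM x x^-1; rewrite divff // field_norm1.
by move/eqP; apply: contraTneq => ->; rewrite mul0r oner_eq0.
Qed.

End FieldNorm.

(** * The norm of L over K' through the fixed field *)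

Lemma det_mxdiag (R : comNzRingType) m (p_ : 'I_m -> nat)
    (B : forall i, 'M[R]_(p_ i)) : \det (mxdiag B) = \prod_i \det (B i).
Proof.
have det_cast d d' (e : d = d') (A : 'M[R]_d) : \det (castmx (e, e) A) = \det A.
  by case: _ / e.
elim: m p_ B => [|m IH] p_ B; last first.
  by rewrite mxdiag_recl det_cast det_ublock big_ord_recl IH.
have e : (\sum_(i < 0) p_ i = 0)%N by rewrite big_ord0.
by rewrite [RHS]big_ord0 -(det_cast _ _ e) det_mx00.
Qed.

Section Tower.
Variables (k : fieldType) (L : fieldExtType k) (M : {subfield L}).
Let K : fieldExtType k := subvs_of M.

(** [L] is a direct sum of [m] copies of [K], so in a suitable basis the
multiplication by [q] on [L[t]] is block diagonal with [m] equal blocks. *)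
Lemma poly_norm_subfield m (q : {poly K}) :
    \dim {:L} = (m * \dim {:K})%N ->
  poly_norm (map_poly (vsval : K -> L) q) = poly_norm q ^+ m.
Proof.
move=> dimL; have modM : (M * fullv <= fullv)%VS by rewrite subvf.
have [X [_ _] [defX _]] := field_module_semisimple modM.
have Em : m = \dim_M {:L}.
  by rewrite dimL [\dim {:K}]dimvf mulnK // adim_gt0.
rewrite -Em in X defX.
pose kappa := vbasis {:K}; pose d := \dim {:K}.
pose N := (\sum_(i < m) d)%N.
have NE : N = \dim {:L} by rewrite /N sum_nat_const card_ord dimL.
pose s1 (t : 'I_N) : 'I_m := tagnat.sig1 t; pose s2 (t : 'I_N) : 'I_d := tagnat.sig2 t.
pose b := [tuple vsval kappa`_(s2 t) * X`_(s1 t) | t < N].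
have bE (t : 'I_N) : b`_t = vsval kappa`_(s2 t) * X`_(s1 t).
  by rewrite -tnth_nth tnth_mktuple.
have sumN (V : nmodType) (G : 'I_m -> 'I_d -> V) :
    \sum_t G (s1 t) (s2 t) = \sum_i \sum_j G i j.
  by rewrite sig_big_dep (reindex _ (tagnat.sig_bij_on (p_ := fun=> d))) .
have mulK (c : K) (i : 'I_m) : vsval c * X`_i =
    \sum_j coord kappa j c *: (vsval kappa`_j * X`_i).
  rewrite {1}(coord_vbasis (memvf c)) raddf_sum mulr_suml.
  by apply: eq_bigr => j _; rewrite -scalerAl.
have bb : basis_of fullv b.
  rewrite basisEdim [X in (X <= _)%N]size_tuple -NE leqnn andbT; apply/subvP => u.
  rewrite -defX => /memv_sumP[v vP ->]; apply: rpred_sum => i _.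
  have /memv_cosetP[c Mc ->] := vP i isT.
  rewrite -(vsprojK Mc) mulK; apply: rpred_sum => j _; apply: rpredZ.
  pose t : 'I_N := tagnat.Rank (p_ := fun=> d) i j.
  have -> : vsval kappa`_j * X`_i = b`_t.
    by rewrite bE /s1 tagnat.Rank1K /s2 tagnat.Rank2K.
  by rewrite memv_span // mem_nth // size_tuple.
have mulb (c : K) : mulmat b (vsval c) =
    \matrix_(t, t') if s1 t == s1 t' then mulmat kappa c (s2 t) (s2 t') else 0.
  apply: mulmat_uniq => // t; rewrite bE mulrA -rmorphM mulK.
  under [RHS]eq_bigr => t' _ do rewrite mxE bE.
  rewrite (sumN _ (fun i j => (if s1 t == i then mulmat kappa c (s2 t) j else 0) *:
    (vsval kappa`_j * X`_i))).
  rewrite (bigD1 (s1 t)) //= eqxx [X in _ + X]big1 ?addr0 => [|i /negPf ne_i]; last first.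
    by rewrite big1 // => j _; rewrite eq_sym ne_i scale0r.
  by apply: eq_bigr => j _; rewrite mxE.
rewrite /poly_norm (det_polymat _ (vbasisP _) bb).
have -> : polymat b (map_poly (vsval : K -> L) q) =
    mxdiag (fun _ : 'I_m => polymat kappa q).
  apply/matrixP => t t'; apply/polyP => l; rewrite coef_polymat coef_map mulb !mxE.
  rewrite -/(s1 t) -/(s1 t'); case: eqP => _; last by rewrite mxE coef0.
  by rewrite conform_mx_id -/(s2 t) -/(s2 t') coef_polymat [RHS]mxE.
by rewrite det_mxdiag prodr_const card_ord.
Qed.

End Tower.

Section CyclicTower.
Variables (k : fieldType) (L : fieldExtType k) (sigma : 'AEnd(L)) (n : nat).
Hypothesis sigma_n : is_order sigma n.
Let K := fixed_field sigma.
Hypothesis dimL : \dim {:L} = (n * \dim {:K})%N.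

Lemma poly_descent (p : {poly L}) : map_poly sigma p = p ->
  exists q : {poly K}, map_poly vsval q = p.
Proof.
move=> sp; exists (map_poly (vsproj (fixedSpace sigma)) p).
apply/polyP => l; rewrite !coef_map /= vsprojK //.
by apply/fixedSpaceP; rewrite -[in RHS]sp coef_map.
Qed.

Lemma iter_poly_aut i (p : {poly L}) :
  iter i (map_poly sigma) p = map_poly (iter i sigma) p.
Proof.
elim: i => [|i IH] /=; first by rewrite map_poly_id.
rewrite IH; apply/polyP => l.
by rewrite coef_map !coef_map_id0 // ?iterS ?iter_rmorph0 ?rmorph0.
Qed.

Lemma poly_norm_iter i p : poly_norm (iter i (map_poly sigma) p) = poly_norm p.
Proof. by elim: i => //= i IH; rewrite poly_norm_aut. Qed.

(** Comparing norms over [k] determines the two sides only up to an [n]-th root of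
unity; over [k[t]] it determines them up to a constant, which evaluation at a
second point shows to be 1. *)
Lemma field_norm_cyclic (x : L) (z : K) :
  vsval z = \prod_(i < n) iter i sigma x -> field_norm x = field_norm z.
Proof.
move=> zE; have [n_gt0 sn _] := sigma_n.
(* p interpolates between x at 0 and 1 at 1; both norms are then 1 at 1, which
   fixes the constant in the equality of n-th powers. *)
pose p : {poly L} := x%:P + (1 - x)%:P * 'X.
pose r := \prod_(i < n) iter i (map_poly sigma) p.
have r_fix : map_poly sigma r = r.
  rewrite /r; case: (n) n_gt0 sn => // n' _ sn.
  rewrite rmorph_prod big_ord_recr big_ord_recl /= mulrC; congr (_ * _).
  rewrite -iterS iter_poly_aut; apply/polyP => l.
  by rewrite coef_map_id0 ?iter_rmorph0 ?sn.
have [q qE] := poly_descent r_fix.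
have PQ : poly_norm p ^+ n = poly_norm q ^+ n.
  rewrite -(poly_norm_subfield _ dimL) qE /r.
  rewrite (big_morph _ (@poly_normM _ _) (poly_norm1 _)).
  under [RHS]eq_bigr => i _ do rewrite poly_norm_iter.
  by rewrite prodr_const card_ord.
have rE a : r.[a%:A] = \prod_(i < n) iter i sigma p.[a%:A].
  rewrite /r horner_prod; apply: eq_bigr => i _.
  elim: (nat_of_ord i) => //= j <-.
  by rewrite -[in RHS]horner_map /= rmorph_alg.
have qr a : vsval q.[a%:A] = r.[a%:A].
  by rewrite -qE -[in RHS](rmorph_alg (vsval : K -> L)) horner_map.
have p0 : p.[0%:A] = x by rewrite scale0r /p !hornerE.
have p1 : p.[1%:A] = 1.
  by rewrite scale1r /p hornerD hornerM !hornerC hornerX mulr1 addrC subrK.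
have q0 : q.[0%:A] = z by apply: val_inj; rewrite /= qr rE zE p0.
have q1 : q.[1%:A] = 1.
  apply: subvs_inj; rewrite qr rE p1 [RHS]rmorph1 big1 // => i _; exact: iter_rmorph1.
have P1 : (poly_norm p).[1] = 1 by rewrite horner_poly_norm p1 field_norm1.
have Q1 : (poly_norm q).[1] = 1 by rewrite horner_poly_norm q1 field_norm1.
have eqPQ : poly_norm p %= poly_norm q.
  by rewrite /eqp -(dvdp_pexp2r _ _ n_gt0) PQ dvdpp -(dvdp_pexp2r _ _ n_gt0) PQ dvdpp.
suff -> : field_norm x = (poly_norm q).[0] by rewrite horner_poly_norm q0.
rewrite -p0 -horner_poly_norm.
have /eqpP[[c1 c2] /= /andP[nz1 nz2] cE] := eqPQ.
have := congr1 (horner^~ 1) cE; rewrite !hornerZ P1 Q1 !mulr1 => c12.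
have := congr1 (horner^~ 0) cE; rewrite !hornerZ c12; exact: mulfI.
Qed.

End CyclicTower.

(** * The module R/Rg as a semilinear map on rows *)

Section SkewModule.
Variables (L : fieldType) (s : {rmorphism L -> L}) (d : nat) (C : 'M[L]_d).
Implicit Types (p q : {poly L}) (v w : 'rV[L]_d).

(** The semilinear operator through which the indeterminate acts; for [C] the
companion matrix of [g], this is multiplication by [x] on [R/Rg] in the basis of
powers of [x]. *)
Definition twist v : 'rV[L]_d := map_mx s v *m C.
Definition skew_act p v : 'rV[L]_d := \sum_(i < size p) p`_i *: iter i twist v.

Lemma twistD v w : twist (v + w) = twist v + twist w.
Proof. by rewrite /twist map_mxD mulmxDl. Qed.

Lemma twistZ c v : twist (c *: v) = s c *: twist v.
Proof. by rewrite /twist map_mxZ scalemxAl. Qed.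

Lemma twist0 : twist 0 = 0. Proof. by rewrite /twist map_mx0 mul0mx. Qed.

Lemma iter_twistD i v w : iter i twist (v + w) = iter i twist v + iter i twist w.
Proof. by elim: i => //= i ->; rewrite twistD. Qed.

Lemma iter_twistZ i c v : iter i twist (c *: v) = iter i s c *: iter i twist v.
Proof. by elim: i => //= i ->; rewrite twistZ. Qed.

Lemma iter_twist0 i : iter i twist 0 = 0.
Proof. by elim: i => //= i ->; rewrite twist0. Qed.

Lemma skew_actE N p v : (size p <= N)%N ->
  skew_act p v = \sum_(i < N) p`_i *: iter i twist v.
Proof.
move=> le_pN; rewrite /skew_act.
rewrite (big_ord_widen _ (fun i => p`_i *: iter i twist v) le_pN).
rewrite [RHS](bigID (fun i : 'I_N => (i < size p)%N)) /=.
rewrite [X in _ = _ + X]big1 ?addr0 // => i.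
by rewrite -leqNgt => le_pi; rewrite nth_default ?scale0r.
Qed.

Lemma skew_actD p q v : skew_act (p + q) v = skew_act p v + skew_act q v.
Proof.
pose N := maxn (size p) (size q).
rewrite !(@skew_actE N) ?leq_maxl ?leq_maxr ?size_polyD // -big_split /=.
by apply: eq_bigr => i _; rewrite coefD scalerDl.
Qed.

Lemma skew_act0p v : skew_act 0 v = 0.
Proof. by rewrite /skew_act size_poly0 big_ord0. Qed.

Lemma skew_actp0 p : skew_act p 0 = 0.
Proof. by rewrite /skew_act big1 // => i _; rewrite iter_twist0 scaler0. Qed.

Lemma skew_actZ c p v : skew_act (c *: p) v = c *: skew_act p v.
Proof.
rewrite (@skew_actE (size p)) ?size_scale_leq // scaler_sumr.
by apply: eq_bigr => i _; rewrite coefZ scalerA.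
Qed.

Lemma skew_act_sum (I : Type) (t : seq I) (f : I -> {poly L}) v :
  skew_act (\sum_(j <- t) f j) v = \sum_(j <- t) skew_act (f j) v.
Proof. exact: (big_morph _ (fun p q => skew_actD p q v) (skew_act0p v)). Qed.

Lemma skew_actXn i v : skew_act 'X^i v = iter i twist v.
Proof.
rewrite /skew_act size_polyXn big_ord_recr /= coefXn eqxx scale1r big1 ?add0r //.
by move=> j _; rewrite coefXn ltn_eqF // scale0r.
Qed.

Lemma skew_act_shift i q v :
  skew_act (skew_shift s i q) v = iter i twist (skew_act q v).
Proof.
have le_iq : (size (skew_shift s i q) <= i + size q)%N.
  apply/leq_sizeP => j le_j; rewrite coef_skew_shift.
  rewrite ltnNge (leq_trans (leq_addr _ _) le_j) /= nth_default ?iter_rmorph0 //.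
  by rewrite leq_subRL // (leq_trans (leq_addr _ _) le_j).
rewrite (skew_actE _ le_iq) big_split_ord /= big1 => [|j _]; last first.
  by rewrite coef_skew_shift ltn_ord scale0r.
rewrite add0r (big_morph _ (iter_twistD i) (iter_twist0 i)).
apply: eq_bigr => j _.
by rewrite coef_skew_shift ltnNge leq_addr /= addKn iter_twistZ iterD.
Qed.

Lemma skew_act_mul p q v : skew_act (skew_mul s p q) v = skew_act p (skew_act q v).
Proof.
rewrite /skew_mul skew_act_sum; apply: eq_bigr => i _.
by rewrite skew_actZ skew_act_shift.
Qed.

(** The linear part of the [i]-th power of [twist]: the product of the
conjugates of [C], the most conjugated factor on the left. *)
Fixpoint twist_mx i : 'M[L]_d :=
  if i is i'.+1 then map_mx s (twist_mx i') *m C else 1%:M.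

Lemma iter_twistE i v : iter i twist v = map_mx (iter i s) v *m twist_mx i.
Proof.
elim: i => [|i IH] /=; first by rewrite mulmx1 map_mx_id.
rewrite IH /twist map_mxM mulmxA; congr (_ *m _ *m _).
by apply/matrixP => a b; rewrite !mxE.
Qed.

Lemma det_twist_mx i : \det (twist_mx i) = \prod_(j < i) iter j s (\det C).
Proof.
elim: i => [|i IH] /=; first by rewrite big_ord0 det1.
rewrite det_mulmx det_map_mx IH rmorph_prod big_ord_recl /= mulrC.
by congr (_ * _); apply: eq_bigr.
Qed.

Variable n : nat.
Hypothesis sn : iter n s =1 id.
Let A := twist_mx n.

Lemma iter_twist_mul j v : iter (n * j) twist v = v *m A ^+ j.
Proof.
elim: j v => [|j IH] v; first by rewrite muln0 expr0 mulmx1.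
rewrite mulnS iterD IH iter_twistE exprSr mulmxA; congr (_ *m _).
by apply/matrixP => a b; rewrite mxE sn.
Qed.

(** [twist] commutes with its own [n]-th power, which is linear. *)
Lemma twist_mx_comm : map_mx s A *m C = C *m A.
Proof.
apply/row_matrixP => i; rewrite !row_mul.
have T v : iter n twist v = v *m A by have := iter_twist_mul 1 v; rewrite muln1.
have := congr1 (fun f : nat => iter f twist (delta_mx 0 i)) (erefl n.+1).
rewrite {1}iterS iterSr !T /twist map_mxM map_delta_mx /= !rowE -!mulmxA.
by rewrite /= !mulmxA.
Qed.

(** For invertible [C], the previous commutation says that [s(A)] and [A] are
similar. *)
Lemma twist_char_poly_fixed : \det C != 0 ->
  map_poly s (char_poly A) = char_poly A.
Proof.
move=> C_n0; rewrite map_char_poly.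
have : char_poly_mx (map_mx s A) *m map_mx polyC C = map_mx polyC C *m char_poly_mx A.
  rewrite /char_poly_mx mulmxBl mulmxBr -!map_mxM twist_mx_comm.
  by rewrite mul_scalar_mx mul_mx_scalar.
move/(congr1 determinant); rewrite !det_mulmx det_map_mx mulrC.
by move/mulfI; apply; rewrite polyC_eq0.
Qed.

Lemma skew_act_comp_Xn p v :
  skew_act (p \Po 'X^n) v = v *m \sum_(j < size p) p`_j *: A ^+ j.
Proof.
rewrite comp_polyE skew_act_sum mulmx_sumr; apply: eq_bigr => j _.
by rewrite skew_actZ -exprM skew_actXn iter_twist_mul scalemxAr.
Qed.

End SkewModule.

(** If [p(A) = 0], the matrix [p(X) I = p(X) I - p(A)] is a multiple of
[X I - A], because [X^j - A^j] is; the claim follows by taking determinants. *)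
Lemma char_poly_dvd (L : fieldType) d (A : 'M[L]_d) (p : {poly L}) :
  \sum_(j < size p) p`_j *: A ^+ j = 0 -> char_poly A %| p ^+ d.
Proof.
move=> pA0; pose Y : 'M[{poly L}]_d := 'X%:M; pose A' : 'M[{poly L}]_d := map_mx polyC A.
have [B BE] : exists B, p%:M = char_poly_mx A *m B.
  have mapX j : map_mx polyC (A ^+ j) = A' ^+ j.
    elim: j => [|j IH]; first by rewrite !expr0 map_scalar_mx.
    by rewrite !exprS -IH; exact: map_mxM.
  have YX j : ('X^j)%:M = Y ^+ j.
    elim: j => [|j IH]; first by rewrite !expr0.
    by rewrite !exprS -IH; exact: scalar_mxM.
  exists (\sum_(j < size p) (p`_j)%:P *: \sum_(i < j) Y ^+ (j.-1 - i) * A' ^+ i).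
  have A0 : \sum_(j < size p) (p`_j)%:P *: A' ^+ j = 0.
    transitivity (map_mx polyC (\sum_(j < size p) p`_j *: A ^+ j)).
      rewrite raddf_sum; apply: eq_bigr => j _ /=.
      by rewrite map_mxZ mapX.
    by rewrite pA0 map_mx0.
  transitivity (p%:M - \sum_(j < size p) (p`_j)%:P *: A' ^+ j).
    by rewrite A0 subr0.
  rewrite -{1}[p]coefK poly_def mulmx_sumr.
  rewrite (raddf_sum (@scalar_mx _ d)) -sumrB /=; apply: eq_bigr => j _.
  rewrite -mul_polyC -scale_scalar_mx YX -scalerBr -scalemxAr; congr (_ *: _).
  have cYA : GRing.comm Y A' by exact: (comm_mx_sym (comm_mx_scalar _ _)).
  exact: subrXX_comm.
by rewrite -[p ^+ d]det_scalar BE det_mulmx dvdp_mulr.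
Qed.

Lemma monic_dvd_irreducible_exp (K : fieldType) (F c : {poly K}) d :
  irreducible_poly F -> F \is monic -> c \is monic -> c %| F ^+ d ->
  exists j, c = F ^+ j.
Proof.
move=> Fi Fm; elim: d c => [|d IH] c cm.
  rewrite expr0 dvdp1 size_poly_eq1 => c1; exists 0%N; apply/eqP.
  by rewrite expr0 -eqp_monic ?monic1.
have [Fc | nFc] := boolP (F %| c).
  have /dvdpP[c' cE] := Fc; subst c; rewrite monicMr // in cm.
  rewrite exprSr dvdp_mul2r ?monic_neq0 // => /(IH _ cm)[j ->].
  by exists j.+1; rewrite exprSr.
have cop : coprimep c F by rewrite coprimep_sym irreducible_poly_coprime.
by rewrite exprS Gauss_dvdpr //; exact: IH.
Qed.

(** * Constant coefficients of right divisors of F(x^n) *)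

Lemma coef0_skew_mul (R : nzRingType) (s : {rmorphism R -> R}) (p q : {poly R}) :
  (skew_mul s p q)`_0 = p`_0 * q`_0.
Proof.
rewrite (skew_mulE _ _ (leqnSn _)) coef_sum big_ord_recl /= coefZ.
rewrite coef_skew_shift /= big1 ?addr0 // => i _.
by rewrite coefZ coef_skew_shift /= mulr0.
Qed.

Section RightDivisor.
Variables (L : fieldType) (s : {rmorphism L -> L}) (g : {poly L}).
Hypotheses (gm : g \is monic) (g_gt1 : (1 < size g)%N).
Let d := (size g).-1.
Let C : 'M[L]_d := companionmx g.
Let d_gt0 : (0 < d)%N. Proof. by rewrite /d -subn1 subn_gt0. Qed.
Let e0 : 'rV[L]_d := delta_mx 0 (Ordinal d_gt0).

(** The class of [1] generates: its images under the powers of [x] are the unit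
rows. *)
Lemma iter_twist_companion (i : 'I_d) : iter i (twist s C) e0 = delta_mx 0 i.
Proof.
case: i => i; elim: i => [|i IH] lt_id /=; first by congr delta_mx; apply: val_inj.
rewrite (IH (ltnW lt_id)) /twist map_delta_mx mulmx_delta_companion.
by congr delta_mx; apply: val_inj.
Qed.

(** The last row of the companion matrix expresses [x^d = - sum_(j < d) g_j x^j],
that is, [g] annihilates the class of [1]. *)
Lemma skew_act_companion0 : skew_act s C g e0 = 0.
Proof.
have sg : size g = d.+1 by rewrite /d prednK // ltnW.
rewrite (@skew_actE _ _ _ _ d.+1) ?sg // big_ord_recr /=.
have -> : g`_d = 1 by move/monicP: gm; rewrite lead_coefE sg.
have lt_d : (d.-1 < d)%N by rewrite prednK.
have -> : iter d (twist s C) e0 = row (Ordinal lt_d) C.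
  transitivity (iter d.-1.+1 (twist s C) e0); first by congr iter; rewrite prednK.
  rewrite iterS -[d.-1]/(val (Ordinal lt_d)).
  by rewrite iter_twist_companion /twist map_delta_mx rowE.
apply/rowP => j; rewrite scale1r mxE summxE (bigD1 j) //= !mxE eqxx.
rewrite iter_twist_companion mxE !eqxx mulr1 big1 ?addr0 ?subrr // => i ne_ij.
by rewrite mxE iter_twist_companion mxE eq_sym (negPf ne_ij) andbF mulr0.
Qed.

(** A central multiple of [g] annihilates the generator, hence the whole
module. *)
Lemma skew_act_right_multiple (h c : {poly L}) (i : 'I_d) :
    skew_mul s h g = c -> (forall p, skew_mul s p c = skew_mul s c p) ->
  skew_act s C c (delta_mx 0 i) = 0.
Proof.
move=> hg cC; rewrite -iter_twist_companion -skew_actXn -skew_act_mul -cC.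
by rewrite -hg !skew_act_mul skew_act_companion0 !skew_actp0.
Qed.

(** The polynomial [chi] is the characteristic polynomial of the action of [x^n]
on [R/Rg].  The assumption on [g`_0] makes the companion matrix invertible, as is
needed for [chi] to be fixed by [s]. *)
Lemma char_poly_right_divisor n (h F : {poly L}) :
    iter n s =1 id -> skew_mul s h g = F \Po 'X^n ->
    (forall p, skew_mul s p (F \Po 'X^n) = skew_mul s (F \Po 'X^n) p) ->
    g`_0 != 0 ->
  exists chi : {poly L}, [/\ map_poly s chi = chi, chi \is monic, size chi = size g,
     chi %| F ^+ d & chi`_0 = (-1) ^+ (d * n.+1) * \prod_(i < n) iter i s g`_0].
Proof.
move=> sn hg cC g0; pose A := twist_mx s C n; exists (char_poly A).
have detC : \det C = (-1) ^+ d * g`_0.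
  have := char_poly_det C; rewrite (companionmxK gm) => ->.
  by rewrite mulrA -expr2 sqrr_sign mul1r.
split; [|exact: char_poly_monic|by rewrite size_char_poly prednK // ltnW| |].
- by rewrite (twist_char_poly_fixed sn) // detC mulf_neq0 ?signr_eq0.
- apply: char_poly_dvd; apply/row_matrixP => i; rewrite row0 rowE.
  by rewrite -(skew_act_comp_Xn _ sn) (skew_act_right_multiple _ hg).
rewrite char_poly_det det_twist_mx detC.
under eq_bigr => i _ do rewrite iter_rmorphM.
rewrite big_split mulnS exprD -mulrA; congr (_ * (_ * _)).
rewrite (eq_bigr (fun=> (-1) ^+ d)) => [|i _].
  by rewrite prodr_const card_ord exprM.
by elim: (val i) => //= j ->; rewrite rmorph_sign.
Qed.

End RightDivisor.

Section RightDivisorNorm.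
Variables (K' : fieldType) (L : fieldExtType K') (sigma : 'AEnd(L)) (n : nat).
Hypothesis sigma_n : is_order sigma n.
Let K := fixed_field sigma.

(** Over the fixed field, [chi] is a monic divisor of a power of the irreducible
[F], hence a power of [F], and its degree [ks] makes it [F^k]. *)
Lemma right_divisor_coef0 (s k : nat) (F : {poly K}) (g h : {poly L}) :
    monic_irreducible_poly F -> size F = s.+1 -> (0 < k)%N ->
    g \is monic -> size g = (k * s).+1 ->
    skew_mul (sigma : {rmorphism L -> L}) h g = at_xn n F ->
  vsval ((-1) ^+ (s * k * (n - 1)) * F`_0 ^+ k) = \prod_(i < n) iter i sigma g`_0.
Proof.
move=> [Fi Fm] sF k_gt0 gm sg hg; have [n_gt0 sn _] := sigma_n.
have s_gt0 : (0 < s)%N by have [] := Fi; rewrite sF.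
rewrite rmorphM rmorph_sign rmorphXn /=.
(* A vanishing constant coefficient of g forces F_0 = 0, and both sides are 0. *)
have [g0 | g0] := eqVneq g`_0 0.
  have F0 : vsval F`_0 = 0.
    have := congr1 (fun p : {poly L} => p`_0) hg.
    rewrite /= coef0_skew_mul g0 mulr0 /at_xn coef_comp_poly_Xn // dvdn0 div0n.
    by rewrite coef_map.
  rewrite F0 expr0n (gtn_eqF k_gt0) mulr0; case: (n) n_gt0 => // n' _.
  by rewrite big_ord_recl /= g0 mul0r.
have g1 : (1 < size g)%N by rewrite sg ltnS muln_gt0 k_gt0.
have cC p := at_xn_central sigma_n F p.
have [chi [chi_s chi_m chi_sz chi_F chi0]] := char_poly_right_divisor gm g1 sn hg cC g0.
have [q qE] := poly_descent chi_s.
have qm : q \is monic by rewrite -(map_monic (vsval : K -> L)) qE.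
have := chi_F; rewrite -qE -rmorphXn dvdp_map => qF.
have [j qj] := monic_dvd_irreducible_exp Fi Fm qm qF.
have jk : j = k.
  have := size_exp F j; rewrite -qj -(size_map_poly (vsval : K -> L)) qE chi_sz sg sF /=.
  by rewrite mulnC => /eqP; rewrite eqn_pmul2l // => /eqP.
have : chi`_0 = vsval F`_0 ^+ k.
  by rewrite -qE qj jk coef_map /= -!horner_coef0 horner_exp rmorphXn.
rewrite chi0 sg /= => <-; rewrite mulrA -exprD.
have -> : (s * k * (n - 1) + k * s * n.+1)%N = (2 * (k * s * n))%N.
  case: (n) n_gt0 => // n' _; rewrite subn1 (mulnC s) -mulnDr mulnCA.
  by congr (_ * _)%N; rewrite mul2n -addnn addSn !addnS.
by rewrite exprM sqrrN expr1n expr1n mul1r.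
Qed.

End RightDivisorNorm.

(** * Right division in a skew polynomial ring *)

Section SkewDivision.
Variables (L : fieldType) (s : {rmorphism L -> L}).

Lemma iter_rmorph_eq0 i (x : L) : (iter i s x == 0) = (x == 0).
Proof. by elim: i => //= i IH; rewrite fmorph_eq0. Qed.

(** The leading term of [b] is cancelled by [c x^i a], whose leading coefficient
is [c s^i(lead_coef a)]. *)
Lemma skew_right_division (a b : {poly L}) : a != 0 ->
  exists q r, b = skew_mul s q a + r /\ (size r < size a)%N.
Proof.
move=> a0; elim: (size b).+1 {-2}b (ltnSn (size b)) => // N IH {}b le_b.
have [lt_ba | le_ab] := ltnP (size b) (size a).
  by exists 0, b; rewrite skew_mul0p add0r.
pose i := (size b - size a)%N.
pose c := lead_coef b / iter i s (lead_coef a).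
have sa_gt0 : (0 < size a)%N by rewrite size_poly_gt0.
have la0 : iter i s (lead_coef a) != 0 by rewrite iter_rmorph_eq0 lead_coef_eq0.
have szb : size b = (i + (size a).-1).+1 by rewrite -addnS prednK // subnK.
have lt_b' : (size (b - c *: skew_shift s i a)%R < N)%N.
  rewrite -ltnS; apply: leq_trans le_b; rewrite ltnS [leqRHS]szb ltnS.
  apply/leq_sizeP => j le_j; rewrite coefB coefZ coef_skew_shift.
  have le_ij : (i <= j)%N by apply: leq_trans le_j; rewrite leq_addr.
  rewrite ltnNge le_ij /=; move: le_j; rewrite leq_eqVlt => /predU1P[<-|lt_j].
    rewrite addKn -[a`__]/(lead_coef a) divfK // lead_coefE szb /=.
    by rewrite subrr.
  rewrite nth_default ?szb // (@nth_default _ _ a) ?iter_rmorph0 ?mulr0 ?subr0 //.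
  by rewrite -(prednK sa_gt0) ltn_subRL.
have [q [r [bE lt_r]]] := IH _ lt_b'.
exists (q + c *: 'X^i), r; split=> //.
rewrite skew_mulDl -addrA [_ + r]addrC addrA -bE skew_mulZl.
suff -> : skew_mul s 'X^i a = skew_shift s i a by rewrite subrK.
have -> : 'X^i = skew_shift s i 1.
  apply/polyP => l; rewrite coef_skew_shift coefXn coef1.
  case: ltngtP => [// | lt_il | ->]; last by rewrite subnn iter_rmorph1.
  by rewrite subn_eq0 leqNgt lt_il iter_rmorph0.
by rewrite skew_mul_shift skew_mul1p.
Qed.

(** The coefficient at the sum of the degrees is the product of the leading
coefficient of [p] and a conjugate of that of [q], which does not vanish. *)
Lemma size_skew_mul_ge (p q : {poly L}) : p != 0 -> q != 0 ->
  (size q <= size (skew_mul s p q))%N.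
Proof.
move=> p0 q0; have p_gt0 : (0 < size p)%N by rewrite size_poly_gt0.
have q_gt0 : (0 < size q)%N by rewrite size_poly_gt0.
rewrite leqNgt; apply/negP => lt_q.
have : (skew_mul s p q)`_((size p).-1 + (size q).-1) = 0.
  apply: nth_default; apply: leq_trans (leq_addl _ _).
  by rewrite -ltnS prednK.
move/eqP; apply/negP; rewrite /skew_mul coef_sum -(prednK p_gt0) big_ord_recr /=.
rewrite big1 ?add0r => [|i _].
  rewrite coefZ coef_skew_shift ltnNge leq_addr /= addKn mulf_neq0 //.
    by rewrite -[p`__]/(lead_coef p) lead_coef_eq0.
  by rewrite iter_rmorph_eq0 -[q`__]/(lead_coef q) lead_coef_eq0.
rewrite coefZ coef_skew_shift ltnNge (leq_trans (ltnW (ltn_ord i)) (leq_addr _ _)) /=.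
rewrite (@nth_default _ _ q) ?iter_rmorph0 ?mulr0 //.
rewrite -(prednK q_gt0) -addnBAC ?(ltnW (ltn_ord i)) // -[X in (X < _)%N]add0n.
by rewrite ltn_add2r subn_gt0.
Qed.

End SkewDivision.

(** * Linear maps into matrices, and the MRD criterion *)

Section ScalarLinear.
Variables (k : fieldType) (V : vectType k) (E : fieldExtType k) (p q : nat).
Variable G : V -> 'M[E]_(p, q).

(** The spaces 'M[E]_(p, q) carry a module structure over [E] only; this is
[k]-linearity with [k] acting through its image in [E]. *)
Definition scalar_linear := forall (c : k) u v, G (c *: u + v) = c%:A *: G u + G v.
Hypothesis Glin : scalar_linear.

(** Families of elements of [E] form a vector space over [k], in which dimensions
can be counted. *)
Definition entries u : {ffun 'I_p * 'I_q -> E} := [ffun ij => G u ij.1 ij.2].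

Lemma entries_linear : linear entries.
Proof.
move=> c u v; apply/ffunP => ij; rewrite !ffunE Glin !mxE.
by rewrite mulr_algl.
Qed.
HB.instance Definition _ := GRing.isLinear.Build k V _ _ entries entries_linear.

Let h : 'Hom(V, {ffun 'I_p * 'I_q -> E}) := linfun entries.

Lemma entries_eq0 u : (h u == 0) = (G u == 0).
Proof.
rewrite lfunE; apply/eqP/eqP => [/ffunP h0 | G0].
  by apply/matrixP => i j; have := h0 (i, j); rewrite !ffunE mxE.
by apply/ffunP => ij; rewrite !ffunE G0 mxE.
Qed.

Lemma dim_entries : \dim {: {ffun 'I_p * 'I_q -> E}} = (p * q * \dim {:E})%N.
Proof. by rewrite !dimvf /dim /= card_prod !card_ord. Qed.

Lemma scalar_linear_ker : (p * q * \dim {:E} < \dim {:V})%N ->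
  exists u, u != 0 /\ G u = 0.
Proof.
rewrite -dim_entries => lt_dim; pose u := vpick (lker h); exists u.
have u_ker : u \in lker h by exact: memv_pick.
split; last by apply/eqP; rewrite -entries_eq0 -memv_ker.
rewrite vpick0 -dimv_eq0 -lt0n.
have := limg_ker_dim h fullv; rewrite capfv => dimE.
rewrite -(ltn_add2r (\dim (limg h))) dimE add0n.
exact: leq_ltn_trans (dimvS (subvf _)) lt_dim.
Qed.

Lemma scalar_linear_surj : (forall M, exists u, G u = M) ->
  (p * q * \dim {:E} <= \dim {:V})%N /\
  ((\dim {:V} <= p * q * \dim {:E})%N -> forall u, G u = 0 -> u = 0).
Proof.
move=> Gsurj; rewrite -dim_entries.
have img : limg h = fullv.
  apply/vspaceP => y; rewrite memvf; apply/memv_imgP.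
  have [u Gu] := Gsurj (\matrix_(i, j) y (i, j)).
  exists u; rewrite ?memvf // lfunE; apply/ffunP => -[i j].
  by rewrite ffunE Gu mxE.
have := limg_ker_dim h fullv; rewrite capfv img => <-; split; first exact: leq_addl.
rewrite -[leqRHS]add0n leq_add2r leqn0 dimv_eq0 => /eqP ker0 u Gu.
by apply/eqP; rewrite -memv0 -ker0 memv_ker entries_eq0 Gu.
Qed.

End ScalarLinear.

Section MRD.
Variables (k0 : fieldType) (V : vectType k0) (E : fieldExtType k0) (n k : nat).

(** Given the lower bound on the rank, the dimension of the code forces equality
in the Singleton bound: the first [k - 1] rows take fewer than [\dim V] scalars
to prescribe, so they vanish on a nonzero codeword, whose rank is then at most
[n - (k - 1)]. *)
Lemma MRD_of_rank_bound (t : V -> 'M[E]_n) (C : set 'M[E]_n) :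
    scalar_linear t -> (1 <= k <= n)%N -> \dim {:V} = (n * k * \dim {:E})%N ->
    (forall u, u != 0 -> (n - k + 1 <= \rank (t u))%N) ->
    (forall A, C A <-> exists u, A = t u) ->
  MRD_code C (n - k + 1).
Proof.
move=> tlin /andP[k_gt0 le_kn] dimV rk CE.
have t0 : t 0 = 0.
  have := tlin (-1) 0 0; rewrite scaler0 addr0 => {1}->.
  by rewrite scaleN1r scaleNr scale1r addNr.
have tD u v : t (u + v) = t u + t v by rewrite -[u]scale1r tlin !scale1r.
have tZ c u : t (c *: u) = c%:A *: t u by rewrite -[c *: u]addr0 tlin t0 addr0.
have tB u v : t (u - v) = t u - t v by rewrite tD -[- v]scaleN1r tZ scaleN1r scaleNr scale1r.
have tinj u : t u = 0 -> u = 0.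
  by move=> tu; apply/eqP; apply: contraT => /rk; rewrite tu mxrank0 addn1.
split.
- split=> [|A B|c A]; first by apply/CE; exists 0.
    by move=> /CE[u ->] /CE[v ->]; apply/CE; exists (u + v).
  by move=> /CE[u ->]; apply/CE; exists (c *: u).
- split; last first.
    move=> A B /CE[u ->] /CE[v ->] neq; rewrite -tB; apply: rk.
    by apply/eqP => uv; apply: neq; apply/eqP; rewrite -subr_eq0 -tB uv t0.
  pose P : 'M[E]_(k.-1, n) := pid_mx k.-1.
  have Glin : scalar_linear (fun u => P *m t u).
    by move=> c u v; rewrite tlin mulmxDr scalemxAr.
  have [|u [u0 Pu]] := scalar_linear_ker Glin.
    rewrite dimV ltn_pmul2r ?adim_gt0 // mulnC ltn_pmul2l ?prednK //.
    exact: leq_trans le_kn.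
  exists (t u), (t 0); split; [by apply/CE; exists u | by apply/CE; exists 0 | |].
    by rewrite t0 => /tinj/eqP; apply/negP.
  apply/eqP; rewrite eqn_leq t0 subr0 rk // andbT.
  have le_k'n : (k.-1 <= n)%N by apply: leq_trans (leq_pred _) le_kn.
  have := mulmx0_rank_max Pu; rewrite rank_pid_mx // -leq_subRL //.
  by rewrite addn1 -subSn // -{2}(prednK k_gt0) subSS.
set m := (n * _ * _)%N.
have mE : m = \dim {:V} by rewrite dimV /m !addn1 subnS subKn // prednK.
have [b bb] : exists b : m.-tuple V, basis_of fullv b.
  by rewrite mE; exists (vbasis fullv); exact: vbasisP.
have tsum (c : 'I_m -> k0) : t (\sum_i c i *: b`_i) = \sum_i (c i)%:A *: t b`_i.
  rewrite (big_morph t tD t0); by apply: eq_bigr => i _; rewrite tZ.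
exists (fun i => t b`_i); split=> [A | c].
  split=> [/CE[u ->] | [c ->]].
    by exists (fun i => coord b i u); rewrite -tsum -(coord_basis bb (memvf u)).
  by apply/CE; exists (\sum_i c i *: b`_i); rewrite tsum.
rewrite -tsum => /tinj; exact: (freeP (basis_free bb)).
Qed.

End MRD.

(** * Rank and degree *)

Section Rank.
Variables (K' : fieldType) (L : fieldExtType K') (sigma : 'AEnd(L)) (n s : nat).
Variables (E : fieldExtType K') (c : {poly L}).
Variable f : {rmorphism skew_ring sigma -> 'M[E]_n}.
Hypotheses (n_gt0 : (0 < n)%N) (sz_c : size c = (n * s).+1).
Hypothesis f_scal : forall (a : K') (p : {poly L}), f (a%:A *: p : {poly L}) = a%:A *: f p.
Hypothesis f_surj : forall M, exists p, f p = M.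
Hypothesis f_ker : forall p : {poly L}, f p = 0 <-> exists b, p = skew_mul sigma b c.
Let sg := (sigma : {rmorphism L -> L}).

(** Polynomials of size at most [m] over [L], parametrised by a vector space over
[K']: the type of bounded polynomials is one over [L] only. *)
Definition ffun_poly m (u : {ffun 'I_m -> L}) : {poly L} := rVpoly (\row_i u i).

Lemma ffun_polyP m (a : K') (u v : {ffun 'I_m -> L}) :
  ffun_poly (a *: u + v) = a%:A *: ffun_poly u + ffun_poly v.
Proof.
rewrite /ffun_poly -linearP; congr rVpoly; apply/rowP => i.
by rewrite !mxE !ffunE mulr_algl.
Qed.

Lemma size_ffun_poly m (u : {ffun 'I_m -> L}) : (size (ffun_poly u) <= m)%N.
Proof. exact: size_poly. Qed.

Lemma ffun_polyK m (p : {poly L}) : (size p <= m)%N ->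
  ffun_poly [ffun i : 'I_m => p`_i] = p.
Proof.
move=> le_p; rewrite -[RHS](poly_rV_K le_p); congr rVpoly.
by apply/rowP => i; rewrite !mxE ffunE.
Qed.

Lemma ffun_poly0 m : ffun_poly (0 : {ffun 'I_m -> L}) = 0.
Proof.
rewrite /ffun_poly (_ : \row_i _ = 0) ?raddf0 //.
by apply/rowP => i; rewrite !mxE ffunE.
Qed.

Lemma ffun_poly_eq0 m (u : {ffun 'I_m -> L}) : ffun_poly u = 0 -> u = 0.
Proof.
move=> u0; apply/ffunP => i; have := coef_rVpoly_ord (\row_i u i) i.
by rewrite -/(ffun_poly u) u0 coef0 mxE ffunE.
Qed.

Lemma dim_ffun_poly m : \dim {: {ffun 'I_m -> L}} = (m * \dim {:L})%N.
Proof. by rewrite !dimvf /dim /= card_ord. Qed.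

Lemma skew_rmorphM (p q : {poly L}) : f (skew_mul sg p q : {poly L}) = f p *m f q.
Proof. exact: (rmorphM f). Qed.

Lemma skew_rmorphD (p q : {poly L}) : f (p + q : {poly L}) = f p + f q.
Proof. exact: (rmorphD f). Qed.

(** The matrices [v] annihilated by [f a] on the left turn [b |-> f b *m v] into a
linear map that factors through right division by [a]; its image is everything,
so the number of remainders bounds the corank of [f a].  When the dimensions
agree a remainder is determined by its image, so division of an element of
[ker f] leaves no remainder. *)
Lemma corank_bound (a : {poly L}) : a != 0 ->
  (n * (n - \rank (f a)) * \dim {:E} <= (size a).-1 * \dim {:L})%N /\
  (((size a).-1 * \dim {:L} <= n * (n - \rank (f a)) * \dim {:E})%N ->
   forall b : {poly L}, f b = 0 -> exists h, b = skew_mul sg h a).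
Proof.
move=> a0.
(* The columns of v form a basis of the column kernel of f a; being a column
   base, v has a left inverse. *)
pose v := col_base (cokermx (f a)).
have av0 : f a *m v = 0.
  apply: (row_free_inj (row_base_free (cokermx (f a)))).
  by rewrite mul0mx -mulmxA mulmx_base mulmx_coker.
have red (b : {poly L}) : exists h r, [/\ b = skew_mul sg h a + r,
    (size r <= (size a).-1)%N & f b *m v = f r *m v].
  have [h [r [bE lt_r]]] := skew_right_division sg b a0.
  exists h, r; split=> //; first by rewrite -ltnS prednK ?size_poly_gt0.
  have -> : f b = f h *m f a + f r by rewrite bE skew_rmorphD skew_rmorphM.
  by rewrite mulmxDl -mulmxA av0 mulmx0 add0r.
pose G (u : {ffun 'I_((size a).-1) -> L}) := f (ffun_poly u) *m v.
have Glin : scalar_linear G.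
  by move=> x u w; rewrite /G ffun_polyP skew_rmorphD f_scal mulmxDl scalemxAl.
have Gsurj M : exists u, G u = M.
  have /row_fullP[v' vv'] := col_base_full (cokermx (f a)).
  have [b bE] := f_surj (M *m v'); have [h [r [_ le_r br]]] := red b.
  exists [ffun i : 'I_((size a).-1) => r`_i]; rewrite /G ffun_polyK // -br bE -mulmxA vv'.
  by rewrite mulmx1.
have := scalar_linear_surj Glin Gsurj.
rewrite dim_ffun_poly -(mxrank_coker (f a)) => -[le1 le2].
split=> // /le2 Ginj b fb.
have [h [r [bE le_r br]]] := red b; exists h.
suff r0 : r = 0 by rewrite bE r0 addr0.
rewrite -(ffun_polyK le_r); have -> : [ffun i : 'I_((size a).-1) => r`_i] = 0.
  by apply: Ginj; rewrite /G ffun_polyK // -br fb mul0mx.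
exact: ffun_poly0.
Qed.

(** Counting dimensions over K' in the isomorphism of M_n(E) with the polynomials
of degree less than [n s]. *)
Lemma dim_residue : (n * \dim {:E} = s * \dim {:L})%N.
Proof.
have fc0 : f c = 0 by apply/f_ker; exists 1; rewrite skew_mul1p.
have c0 : c != 0 by rewrite -size_poly_eq0 sz_c.
apply/eqP; rewrite -(eqn_pmul2l n_gt0) !mulnA eqn_leq; apply/andP; split.
  by have [] := corank_bound c0; rewrite fc0 mxrank0 subn0 sz_c.
rewrite leqNgt -dim_ffun_poly; apply/negP => lt_dim.
have Glin : scalar_linear (fun u : {ffun 'I_(n * s) -> L} => f (ffun_poly u)).
  by move=> x u w; rewrite ffun_polyP skew_rmorphD f_scal.
have [u [u0 /f_ker[b bE]]] := scalar_linear_ker Glin lt_dim.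
case/negP: u0; apply/eqP/ffun_poly_eq0.
have [b0 | b0] := eqVneq b 0; first by rewrite bE b0 skew_mul0p.
have := leq_trans (size_skew_mul_ge sg b0 c0); rewrite -bE.
by move/(_ _ (size_ffun_poly u)); rewrite sz_c ltnn.
Qed.

End Rank.

(** * The twisted code *)

Lemma dim_residue_field (K' : fieldType) (L : fieldExtType K') (sigma : 'AEnd(L))
    (F : {poly fixed_field sigma}) (F_mi : monic_irreducible_poly F) :
  \dim {: residue_field F_mi} = ((size F).-1 * \dim {: fixed_field sigma})%N.
Proof.
have := dim_baseVspace (fullv : {vspace {poly %/ F with F_mi}}).
have -> : baseVspace (fullv : {vspace {poly %/ F with F_mi}}) = fullv.
  by apply/vspaceP => u; rewrite mem_baseVspace; apply/idP/idP => _; exact: memvf.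
move=> ->; congr (_ * _)%N.
by rewrite dimvf -[in RHS](mk_monicE F_mi).
Qed.

Section TwistedCode.
Variables (K' : fieldType) (L : fieldExtType K') (sigma rho : 'AEnd(L)) (n : nat).
Hypothesis sigma_n : is_order sigma n.
Variables (s : nat) (F : {poly fixed_field sigma}).
Hypotheses (F_mi : monic_irreducible_poly F) (F_deg : size F = s.+1).
Let K := fixed_field sigma.
Let E := residue_field F_mi.
Let sg := (sigma : {rmorphism L -> L}).
Let n_gt0 : (0 < n)%N. Proof. by have [] := sigma_n. Qed.

Lemma residue_class_scalar (a : K') :
  residue_class F_mi (a%:A : K)%:P = (a%:A : E).
Proof.
rewrite /residue_class -[(a%:A)%:P]mulr1 mul_polyC in_qpolyZ in_qpoly1.
by rewrite baseField_scaleE.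
Qed.

Lemma size_at_xn : size (at_xn n F : {poly L}) = (n * s).+1.
Proof.
have s_gt0 : (0 < s)%N by have [[+ _] _] := F_mi; rewrite F_deg.
have := size_comp_poly (map_poly (vsval : K -> L) F) 'X^n.
rewrite size_polyXn size_map_poly F_deg /= mulnC -/(at_xn n F).
by case: (size _) => [/eqP|m /= ->] //; rewrite /= eq_sym muln_eq0 !gtn_eqF.
Qed.

Variable phi : {rmorphism skew_quotient sigma_n F -> 'M[E]_n}.
Hypotheses (phi_bij : bijective phi) (phi_centre : forall z : {poly K},
  phi (to_skew_quotient sigma_n F (at_xn n z)) = (residue_class F_mi z)%:M).

(** Working with a map defined on [R] avoids representatives of classes
modulo F(x^n). *)
Definition lift_phi (p : skew_ring sigma) : 'M[E]_n :=
  phi (to_skew_quotient sigma_n F p).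
HB.instance Definition _ := GRing.RMorphism.copy lift_phi
  (phi \o to_skew_quotient sigma_n F).

(** A scalar of K' is the value at [x^n] of a constant polynomial, so
[phi_centre] makes [phi] K'-linear. *)
Lemma lift_phi_scal (a : K') (p : {poly L}) :
  lift_phi (a%:A *: p : {poly L}) = a%:A *: lift_phi p.
Proof.
have -> : a%:A *: p = skew_mul sg (a%:A)%:P p.
  by rewrite -[(a%:A)%:P]mulr1 mul_polyC skew_mulZl skew_mul1p.
have -> : (a%:A)%:P = (at_xn n (a%:A : K)%:P : {poly L}).
  rewrite /at_xn map_polyC comp_polyC; congr polyC.
  exact: (esym (rmorph_alg (vsval : K -> L) a)).
rewrite [LHS](rmorphM lift_phi) /= {1}/lift_phi phi_centre residue_class_scalar.
exact: mul_scalar_mx.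
Qed.

Lemma lift_phi_surj M : exists p, lift_phi p = M.
Proof.
have [psi _ phiK] := phi_bij; have [a aE] := central_pi_surj (psi M).
by exists a; rewrite /lift_phi -[RHS]phiK aE.
Qed.

Lemma lift_phi_ker (p : {poly L}) :
  lift_phi p = 0 <-> exists b, p = skew_mul sg b (at_xn n F).
Proof.
have [psi psiK _] := phi_bij; split=> [p0 | [b ->]].
  have : central_pi (at_xn_central sigma_n F) p == central_pi (at_xn_central sigma_n F) 0.
    apply/eqP; apply: (can_inj psiK); rewrite [RHS](rmorph0 lift_phi); exact: p0.
  by move/central_piP => [b]; rewrite subr0 => bE; exists b.
rewrite -[RHS](rmorph0 lift_phi) /lift_phi; congr (phi _); apply/eqP/central_piP.
by exists b; rewrite subr0.
Qed.

(** Artin's equality [L : K] = n, obtained here by comparing the dimensions of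
[R_F] and of M_n(E_F). *)
Lemma dim_fixed_field : \dim {:L} = (n * \dim {:K})%N.
Proof.
have := dim_residue n_gt0 size_at_xn lift_phi_scal lift_phi_surj lift_phi_ker.
have s_gt0 : (0 < s)%N by have [[+ _] _] := F_mi; rewrite F_deg.
rewrite dim_residue_field F_deg /= mulnCA => /eqP.
by rewrite eqn_pmul2l // => /eqP.
Qed.

Variables (k : nat) (eta : L).
Hypotheses (k_bounds : (1 <= k <= n)%N).
Hypothesis (eta_norm : field_norm eta
   * field_norm ((-1) ^+ (s * k * (n - 1)) * F`_0 ^+ k) != 1).

(** Otherwise the rank is [n - k], [a] is up to a constant a monic right divisor
of F(x^n), and taking norms in [a`_(k * s) = eta * rho a`_0] contradicts
[eta_norm]. *)
Lemma rank_twisted (a : {poly L}) : a != 0 -> (size a <= (k * s).+1)%N ->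
  a`_(k * s) = eta * rho a`_0 -> (n - k + 1 <= \rank (lift_phi a))%N.
Proof.
move=> a0 sa tw; have /andP[k_gt0 le_kn] := k_bounds.
rewrite addn1 ltnNge; apply/negP => le_r.
have [le1 le2] := corank_bound lift_phi_scal lift_phi_surj a0.
(* The degree bound on a and le_k squeeze the inequality of corank_bound into an
   equality. *)
have le_k : (k <= n - \rank (lift_phi a))%N.
  by rewrite leq_subRL ?rank_leq_row // addnC -leq_subRL // (leq_trans le_r).
have dE := dim_residue n_gt0 size_at_xn lift_phi_scal lift_phi_surj lift_phi_ker.
have ks : (k * s * \dim {:L} = n * k * \dim {:E})%N.
  by rewrite -mulnA -dE mulnCA mulnA.
have le_ks : (k * s * \dim {:L} <= n * (n - \rank (lift_phi a)) * \dim {:E})%N.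
  by rewrite ks leq_mul2r leq_mul2l le_k !orbT.
have szP : (size a).-1 = (k * s)%N.
  apply/eqP; rewrite eqn_leq; apply/andP; split; first by rewrite -ltnS prednK ?size_poly_gt0.
  by rewrite -(leq_pmul2r (adim_gt0 {:L})); exact: leq_trans le1.
have sz : size a = (k * s).+1 by rewrite -szP prednK ?size_poly_gt0.
have fF : lift_phi (at_xn n F) = 0.
  by apply/lift_phi_ker; exists 1; rewrite skew_mul1p.
have [|h hE] := le2 _ (at_xn n F) fF; first by rewrite szP.
have la0 : lead_coef a != 0 by rewrite lead_coef_eq0.
pose g := (lead_coef a)^-1 *: a.
have gm : g \is monic by rewrite monicE lead_coefZ mulVf.
have sg_g : size g = (k * s).+1 by rewrite size_scale ?invr_eq0.
have hg : skew_mul sg (skew_mul sg h (lead_coef a)%:P) g = at_xn n F.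
  rewrite -skew_mulA hE; congr skew_mul.
  rewrite -[(lead_coef a)%:P]mulr1 mul_polyC skew_mulZl skew_mul1p.
  by rewrite scalerA divff // scale1r.
have zE := right_divisor_coef0 sigma_n F_mi F_deg k_gt0 gm sg_g hg.
have Ng := field_norm_cyclic sigma_n dim_fixed_field zE.
have aE : a`_0 = lead_coef a * g`_0 by rewrite coefZ mulrA divff // mul1r.
case/negP: eta_norm; rewrite -Ng; apply/eqP.
apply: (mulfI (field_norm_neq0 la0)); rewrite mulr1.
have lE : lead_coef a = eta * rho a`_0 by rewrite lead_coefE sz -tw.
have := congr1 (@field_norm _ _) lE.
by rewrite field_normM field_norm_aut aE field_normM mulrCA => <-.
Qed.

Lemma twisted_code_MRD :
  MRD_code (phi @` twisted_code sigma_n rho s k eta F) (n - k + 1).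
Proof.
have /andP[k_gt0 le_kn] := k_bounds.
have s_gt0 : (0 < s)%N by have [[+ _] _] := F_mi; rewrite F_deg.
have ks_gt0 : (0 < k * s)%N by rewrite muln_gt0 k_gt0.
(* A codeword is determined by its coefficients of degree less than ks; since
   ks > 0 these include the constant one, which prescribes the top one. *)
pose tw (u : {ffun 'I_(k * s) -> L}) : {poly L} :=
  ffun_poly u + (eta * rho (ffun_poly u)`_0) *: 'X^(k * s).
have tw_coef u i : (i < k * s)%N -> (tw u)`_i = (ffun_poly u)`_i.
  by move=> lt_i; rewrite coefD coefZ coefXn ltn_eqF // mulr0 addr0.
have tw_lead u : (tw u)`_(k * s) = eta * rho (tw u)`_0.
  rewrite [in RHS]tw_coef // {1}/tw coefD coefZ coefXn eqxx mulr1 nth_default ?add0r //.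
  exact: size_ffun_poly.
have tw_size u : (size (tw u) <= (k * s).+1)%N.
  apply: leq_trans (size_polyD _ _) _; rewrite geq_max.
  rewrite (leq_trans (size_ffun_poly u)) //=.
  by apply: leq_trans (size_scale_leq _ _) _; rewrite size_polyXn.
apply: (@MRD_of_rank_bound _ {ffun 'I_(k * s) -> L} _ _ _ (fun u => lift_phi (tw u))) => //.
- move=> c u v; rewrite -lift_phi_scal.
  rewrite -[RHS](rmorphD lift_phi); congr lift_phi.
  rewrite /tw ffun_polyP scalerDr scalerA addrACA -scalerDl; congr (_ + _ *: _).
  by rewrite coefD coefZ rmorphD rmorphM /= (rmorph_alg rho) mulrDr mulrCA.
- have dE := dim_residue n_gt0 size_at_xn lift_phi_scal lift_phi_surj lift_phi_ker.
  by rewrite dim_ffun_poly -mulnA -dE mulnCA mulnA.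
- move=> u u0; apply: rank_twisted (tw_size u) (tw_lead u).
  apply: contra_neq u0 => twu0; apply: ffun_poly_eq0; apply/polyP => i.
  have [lt_i | le_i] := ltnP i (k * s); first by rewrite -tw_coef // twu0.
  by rewrite coef0 nth_default // (leq_trans (size_ffun_poly u)).
move=> A; split=> [[_ [a [sa al ->]] <-] | [u ->]]; last first.
  by exists (to_skew_quotient sigma_n F (tw u)) => //; exists (tw u).
exists [ffun i : 'I_(k * s) => a`_i]; rewrite /lift_phi; congr (phi (_ _)).
pose b := \poly_(i < k * s) a`_i.
have -> : [ffun i : 'I_(k * s) => a`_i] = [ffun i : 'I_(k * s) => b`_i].
  by apply/ffunP => i; rewrite !ffunE coef_poly ltn_ord.
rewrite /tw ffun_polyK ?size_poly // {2}/b coef_poly ks_gt0 -al.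
apply/polyP => i; rewrite coefD coefZ coefXn coef_poly.
have [lt_i | lt_i | ->] := ltngtP i (k * s)%N; rewrite ?mulr0 ?mulr1 ?addr0 ?add0r //.
by rewrite nth_default // (leq_trans sa).
Qed.

End TwistedCode.

Theorem theorem6
    (K' : fieldType) (L : fieldExtType K') (sigma rho : 'AEnd(L)) (n : nat)
    (sigma_n : is_order sigma n)
    (s : nat) (F : {poly fixed_field sigma})
    (F_mi : monic_irreducible_poly F) (F_deg : size F = s.+1)
    (phi : {rmorphism skew_quotient sigma_n F -> 'M[residue_field F_mi]_n})
    (phi_bij : bijective phi)
    (phi_centre : forall z : {poly fixed_field sigma},
       phi (to_skew_quotient sigma_n F (at_xn n z)) = (residue_class F_mi z)%:M)
    (k : nat) (k_bounds : (1 <= k <= n)%N) (eta : L)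
    (eta_norm : field_norm eta
                * field_norm ((-1) ^+ (s * k * (n - 1)) * F`_0 ^+ k) != 1) :
  MRD_code (phi @` twisted_code sigma_n rho s k eta F) (n - k + 1).
Proof. exact: twisted_code_MRD. Qed.
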